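(* Let $d\ge 0$ be an integer and let $G$ be a $d$-regular graph that contains no $4$-cycle. If $\mathrm{diam}(G)\geq 6$, then $\varphi(G)=d+1$.
   Context: All graphs are finite and simple (undirected, loopless, without multiple edges), with nonempty vertex set. ''Contains no $4$-cycle'' means that $G$ has no subgraph (not necessarily induced) isomorphic to the cycle $C_4$ of length $4$. The diameter $\mathrm{diam}(G)$ is the supremum of the distances between pairs of vertices of $G$, where two vertices in different connected components have distance $\infty$ (so a disconnected graph has infinite diameter). A b-coloring of a graph $G$ by $k$ colors is a proper vertex coloring with $k$ colors in which each of the $k$ color classes contains a vertex that is adjacent to at least one vertex in each of the other $k-1$ color classes. The b-chromatic number $\varphi(G)$ is the largest integer $k$ such that $G$ admits a b-coloring by $k$ colors. *)

(* Defs.v *)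
From mathcomp Require Import all_boot all_order all_algebra.
From mathcomp Require Import constructive_ereal.

Set Implicit Arguments.
Unset Strict Implicit.
Unset Printing Implicit Defensive.

Record sgraph := SGraph {
  vertex :> finType;
  adj : rel vertex;
  adj_sym : symmetric adj;
  adj_irrefl : irreflexive adj;
  vertex_nonempty : 0 < #|{: vertex}| }.

Definition regular (d : nat) (G : sgraph) : Prop :=
  forall x : G, #|[set y : G | adj x y]| = d.

(* [ucycle] requires the vertices to be pairwise distinct. *)
Definition contains_cycle (n : nat) (G : sgraph) : Prop :=
  exists c : n.-tuple G, ucycle (@adj G) c.

Definition has_walk (G : sgraph) (n : nat) (x y : G) : bool :=
  [exists p : n.-tuple G, path (@adj G) x p && (last x p == y)].

(* Distances live in the extended integers [\bar int], so as to have [+oo].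
   Bounding the length by [#|G|] loses nothing: a shortest walk does not repeat
   a vertex. The empty minimum, for [x] and [y] not connected, is [+oo]. *)
Definition dist (G : sgraph) (x y : G) : \bar int :=
  \big[Order.min/+oo%E]_(n < #|{: G}| | has_walk n x y) (n%:Z)%:E.

Definition diam (G : sgraph) : \bar int :=
  \big[Order.max/0%E]_(x : G) \big[Order.max/0%E]_(y : G) dist x y.

Definition proper_coloring (G : sgraph) (k : nat) (c : {ffun G -> 'I_k}) : bool :=
  [forall x, forall y, adj x y ==> (c x != c y)].

Definition b_coloring (G : sgraph) (k : nat) (c : {ffun G -> 'I_k}) : bool :=
  proper_coloring c &&
  [forall i : 'I_k, exists x : G, (c x == i) &&
    [forall j : 'I_k, (j != i) ==> [exists y : G, adj x y && (c y == j)]]].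

(* All color classes of a b-coloring are nonempty, so it has at most [#|G|]
   colors. *)
Definition b_chromatic (G : sgraph) : nat :=
  \max_(k < #|{: G}|.+1 | [exists c : {ffun G -> 'I_k}, b_coloring c]) k.

(* Main.v *)
(** Around any vertex [v], colour the closed neighbourhood of [v] injectively,
    then complete the neighbourhoods of [d./2] neighbours of [v] one at a time,
    so that [v] and these neighbours dominate [d./2 + 1] distinct colours. When
    the neighbourhood of the [i]-th one is completed, at least [d - 2] of its
    vertices [T] are uncoloured; since there is no 4-cycle, each of them is
    adjacent to at most one vertex in each of the [i - 1] neighbourhoods already
    completed, and each missing colour is thereby forbidden to at most [i - 1]
    vertices of [T], so a conflict-free bijection from [T] to the missing
    colours exists as soon as [2 * (i - 1) <= d - 2].
    Two vertices at distance at least 6 support such colourings without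
    interaction; give them complementary sets of dominated colours, and extend
    greedily to a proper colouring of [G] with [d + 1] colours. *)

Require Import Defs.
From mathcomp Require Import all_boot all_order all_algebra.
From mathcomp Require Import constructive_ereal.
From mathcomp Require Import all_fingroup zify.

Set Implicit Arguments.
Unset Strict Implicit.
Unset Printing Implicit Defensive.

Import Order.TTheory.

(** * Permutations avoiding a sparse relation *)

(* A permutation with the fewest violations has none: each violation could be
   removed by composing with a suitable transposition. *)
Lemma perm_avoiding (T : finType) (A : {set T}) (r : rel T) (k : nat) :
  {in A, forall a, #|[set b in A | r a b]| <= k} ->
  {in A, forall b, #|[set a in A | r a b]| <= k} ->
  k.*2 <= #|A| ->
  exists2 s : {perm T}, perm_on A s & {in A, forall a, ~~ r a (s a)}.
Proof.
move=> rowk colk kA.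
pose bad (s : {perm T}) := [set a in A | r a (s a)].
case: (arg_minnP (fun s => #|bad s|) (perm_on1 A)) => s sA smin.
exists s => // a aA; apply/negP => ras.
have sAE b : (s b \in A) = (b \in A) by apply: perm_closed.
(* After composing with [tperm a b], [a] goes to [s b] and [b] to [s a]: [X] and [Y] collect the [b]
   for which the swap leaves a violation at [a], respectively creates one at [b]. *)
pose X := [set b in A | r a (s b)]; pose Y := [set b in A | r b (s a)].
have Xk : #|X| <= k.
  rewrite -(card_imset _ (@perm_inj _ s)); apply: leq_trans (rowk a aA).
  apply/subset_leq_card/subsetP => _ /imsetP[b bX ->].
  by move: bX; rewrite !inE sAE.
have Yk : #|Y| <= k by apply: colk; rewrite sAE.
have aXY : a \in X :&: Y by rewrite !inE aA ras.
(* Both sets contain [a], so their union has at most [2k - 1] elements, which is what makes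
   [k.*2 <= #|A|] suffice. *)
have XYlt : #|X :|: Y| < #|A|.
  have XYgt0 : 0 < #|X :&: Y| by apply/card_gt0P; exists a.
  by have := cardsUI X Y; lia.
have /subsetPn[b bA] : ~~ (A \subset X :|: Y).
  by apply/negP => /subset_leq_card; rewrite leqNgt XYlt.
rewrite !inE bA /= negb_or => /andP[nras nrbs].
have ab : a != b by apply: contraNneq nras => <-.
have s'A : perm_on A (tperm a b * s)%g.
  apply/subsetP => z; rewrite inE permM.
  case: tpermP => [-> //|-> //|_ _ szz].
  by move/subsetP: sA; apply; rewrite inE.
have := smin _ s'A; rewrite leqNgt => /negP; apply.
apply: proper_card; apply/properP; split; last first.
  by exists a; rewrite inE aA ?permM ?tpermL.
apply/subsetP => z; rewrite !inE permM => /andP[-> /=].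
by case: tpermP => [->|->|//]; rewrite ?(negbTE nras) ?(negbTE nrbs).
Qed.

Lemma card_bigcup_le1 (I T : finType) (A : {set I}) (F : I -> {set T}) :
  {in A, forall i, #|F i| <= 1} -> #|\bigcup_(i in A) F i| <= #|A|.
Proof.
move=> F1; rewrite -[leqRHS]sum1_card.
elim/big_rec2: _ => [|i n X iA leXn]; first by rewrite cards0.
by apply: leq_trans (leq_card_setU _ _) _; rewrite leq_add ?F1.
Qed.

(** * Neighbourhoods, common neighbours and greedy colouring *)

Section Colorings.
Variable G : sgraph.
Implicit Types (x y u v w : G) (S : {set G}).

Definition nbhd x : {set G} := [set y | adj x y].
Definition cnbhd x : {set G} := x |: nbhd x.

Definition proper_on (C : eqType) S (c : G -> C) :=
  {in S &, forall x y, adj x y -> c x != c y}.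

Lemma adjC x y : adj x y = adj y x. Proof. exact: adj_sym. Qed.

Lemma adj_neq x y : adj x y -> x != y.
Proof. by apply: contraTneq => ->; rewrite adj_irrefl. Qed.

Lemma common_neighbor_uniq :
  ~ contains_cycle 4 G ->
  forall x y w w', x != y -> adj x w -> adj y w -> adj x w' -> adj y w' -> w = w'.
Proof.
move=> noC4 x y w w' xy xw yw xw' yw'; apply/eqP/negP => /negP ww'.
apply: noC4; exists [tuple x; w; y; w'].
rewrite /ucycle /= xw (adjC w) yw yw' (adjC w') xw' /= !inE !negb_or.
rewrite !andbT (adj_neq xw) xy (adj_neq xw') ww' (adj_neq yw').
by rewrite (eq_sym w) (adj_neq yw).
Qed.

Lemma greedy_extension k S (c : G -> 'I_k) :
  (forall x, #|nbhd x| < k) -> proper_on S c ->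
  exists2 c' : G -> 'I_k, {in S, c' =1 c} & proper_on setT c'.
Proof.
move=> degk; have [n] := ubnP #|~: S|; elim: n S c => // n IHn S c.
rewrite ltnS => leSn propc.
have [x /= xS|S0] := pickP [pred x | x \notin S]; last first.
  by exists c => // x y _ _; apply: propc; apply/negPn/negbT/S0.
(* The new colour avoids the values of [c] at all neighbours of [x], even the meaningless ones
   outside [S]; the degree bound allows for this. *)
have /subsetPn[i _ iNx] : ~~ ([set: 'I_k] \subset c @: nbhd x).
  apply/negP => /subset_leq_card; rewrite cardsT card_ord leqNgt => /negP; apply.
  exact: leq_ltn_trans (leq_imset_card _ _) (degk x).
pose c1 z := if z == x then i else c z.
have c1S : {in S, c1 =1 c}.
  by move=> z zS; rewrite /c1; case: eqP => // zx; rewrite zx (negbTE xS) in zS.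
have iN y : adj x y -> i != c y.
  by move=> xy; apply: contraNneq iNx => ->; apply: imset_f; rewrite inE.
have [] := IHn (x |: S) c1.
- apply: leq_trans leSn; apply: proper_card; apply/properP; split.
    by apply/subsetP => z; rewrite !inE negb_or => /andP[].
  by exists x; rewrite !inE ?eqxx.
- move=> y z; rewrite !inE /c1; case: (y =P x) => [->|_] /=;
    case: (z =P x) => [->|_] //=.
  + by rewrite adj_irrefl.
  + by move=> _ _ /iN.
  + by move=> _ _; rewrite adjC eq_sym => /iN.
  + exact: propc.
- move=> c' c'1 propc'; exists c' => // z zS.
  by rewrite c'1 ?c1S // inE zS orbT.
Qed.

(** * Walks and distances *)

Lemma walk_dist x (p : seq G) :
  path (@adj G) x p -> (dist x (last x p) <= ((size p)%:Z)%:E)%E.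
Proof.
(* [dist] only minimises over lengths below [#|G|], so the walk is first made repetition-free. *)
case/shortenP=> q xq uq subqp.
have qp : size q <= size p.
  by apply: uniq_leq_size subqp; case/andP: uq.
have qG : size q < #|{: G}| by have := max_card (mem (x :: q)); rewrite (card_uniqP uq).
apply: (@le_trans _ _ ((size q)%:Z)%:E); last by rewrite lee_fin lez_nat.
apply: (bigmin_le_cond _ (j := Ordinal qG)).
by apply/existsP; exists (in_tuple q); rewrite xq eqxx.
Qed.

Lemma diam_far_apart (n : nat) :
  ((n.+1%:Z)%:E <= diam G)%E ->
  exists x, exists y, forall p : seq G,
    path (@adj G) x p -> last x p = y -> n < size p.
Proof.
move=> ndiam.
have [/existsP[x /existsP[y nxy]]|nodist] :=
  boolP [exists x : G, exists y : G, (((n.+1)%:Z)%:E <= dist x y)%E].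
  exists x, y => p xp xpy; rewrite -lez_nat -lee_fin.
  by apply: le_trans nxy _; rewrite -xpy walk_dist.
(* Both maxima start from 0, which lies strictly below the bound because the bound is a
   successor. *)
move: ndiam; rewrite leNgt => /negP[]; apply: bigmax_lt => // x _.
apply: bigmax_lt => // y _; rewrite ltNge; apply: contra nodist => nxy.
by apply/existsP; exists x; apply/existsP; exists y.
Qed.

(** Not a metric ball: these are the vertices already coloured once the neighbourhoods of [v] and of
    all members of [U] are completed. *)
Definition ball v (U : {set G}) : {set G} := cnbhd v :|: \bigcup_(u in U) nbhd u.

Lemma ballP v (U : {set G}) w :
  reflect (w \in cnbhd v \/ exists2 u, u \in U & adj u w) (w \in ball v U).
Proof.
apply: (iffP setUP) => -[wv|]; [by left| |by left|].
- by case/bigcupP=> u uU; rewrite inE => uw; right; exists u.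
- by case=> u uU uw; right; apply/bigcupP; exists u; rewrite ?inE.
Qed.

Lemma ball_walk v (U : {set G}) w :
  U \subset nbhd v -> w \in ball v U ->
  exists p : seq G, [/\ path (@adj G) v p, last v p = w & size p <= 2].
Proof.
move=> /subsetP Uv /ballP[|[u /Uv]]; rewrite !inE.
- by case/orP=> [/eqP->|vw]; [exists [::] | exists [:: w]; rewrite /= vw].
- by move=> vu uw; exists [:: u; w]; rewrite /= vu uw.
Qed.

Lemma path_rev x (p : seq G) :
  path (@adj G) x p ->
  exists q : seq G, [/\ path (@adj G) (last x p) q, last (last x p) q = x
                      & size q = size p].
Proof.
move=> xp; exists (rev (belast x p)); split; last by rewrite size_rev size_belast.
- by rewrite rev_path; apply: sub_path xp => a b; rewrite /= adjC.
- by case: p xp => //= a p _; rewrite rev_cons last_rcons.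
Qed.

(** * Colouring around one vertex *)

Section RegularC4Free.
Variable d : nat.
Hypothesis regG : regular d G.
Hypothesis noC4 : ~ contains_cycle 4 G.

Lemma card_cnbhd x : #|cnbhd x| = d.+1.
Proof. by rewrite cardsU1 inE adj_irrefl regG. Qed.

Lemma card_nbhdI x y : x != y -> #|nbhd x :&: nbhd y| <= 1.
Proof.
move=> xy; apply/card_le1_eqP => w w'; rewrite !inE => /andP[xw yw] /andP[xw' yw'].
exact: (common_neighbor_uniq noC4 xy).
Qed.

(** Only [x], [y] and a single common neighbour can occur. The 3 is what leaves at least [d - 2]
    vertices to colour around a neighbour of [v]. *)
Lemma card_cnbhdI x y : x != y -> #|cnbhd x :&: cnbhd y| <= 3.
Proof.
move=> xy.
have : cnbhd x :&: cnbhd y \subset [set x; y] :|: (nbhd x :&: nbhd y).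
  apply/subsetP => z; rewrite !inE.
  by case: (z == x) (z == y) => [] [].
move/subset_leq_card/leq_trans; apply.
apply: leq_trans (leq_card_setU _ _) _; rewrite cards2 xy.
by rewrite addnC (leq_add (card_nbhdI xy)).
Qed.

(* A vertex of degree [d] dominates all colours exactly when the [d + 1] colours
   are distinct on its closed neighbourhood. *)
Lemma extend_dominating v u (U : {set G}) (c : G -> 'I_d.+1) :
  u \in nbhd v -> U \subset nbhd v -> u \notin U -> #|U| < d./2 ->
  proper_on (ball v U) c -> {in cnbhd v &, injective c} ->
  {in U, forall u', {in cnbhd u' &, injective c}} ->
  exists c' : G -> 'I_d.+1,
    [/\ {in ball v U, c' =1 c}, proper_on (ball v (u |: U)) c'
      & {in cnbhd u &, injective c'}].
Proof.
rewrite inE => vu /subsetP Uv uU Ud propc cv cU.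
pose T := cnbhd u :\: cnbhd v.
pose C := ~: (c @: (cnbhd u :&: cnbhd v)).
have cuv : {in cnbhd u :&: cnbhd v &, injective c}.
  by move=> a b /setIP[_ av] /setIP[_ bv]; apply: cv.
have cardI : #|cnbhd u :&: cnbhd v| <= 3 by rewrite card_cnbhdI // eq_sym adj_neq.
have cardT : #|T| = d.+1 - #|cnbhd u :&: cnbhd v| by rewrite cardsD card_cnbhd.
have cardC : #|C| = #|T|.
  by rewrite cardT -(card_in_imset cuv) cardsCs setCK card_ord.
(* Otherwise [v], [u], [w], [u'] would form a 4-cycle. Hence [T] is still uncoloured, and conflicts
   can only come from the outer vertices of completed neighbourhoods. *)
have TU w u' : w \in T -> u' \in nbhd v -> u' != u -> ~~ adj u' w.
  rewrite !inE negb_or => /andP[/andP[wv vw] uw] vu' u'u; apply/negP => u'w.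
  have {}uw : adj u w by case/orP: uw => // /eqP wu; rewrite wu vu in vw.
  have := common_neighbor_uniq noC4 u'u (_ : adj u' v) (_ : adj u v) u'w uw.
  by rewrite !(adjC _ v) => /(_ vu' vu) vw'; rewrite vw' eqxx in wv.
have Tball w : w \in T -> w \notin ball v U.
  move=> wT; apply/negP => /ballP[wv|[u' u'U]].
    by case/setDP: wT => _ /negP/(_ wv).
  by apply/negP; apply: TU => //; [apply: Uv | apply: contraNneq uU => <-].
have ballS w : w \in ball v (u |: U) -> w \notin T -> w \in ball v U.
  move=> wb wT; apply/ballP; case/ballP: wb => [|[u' + u'w]]; first by left.
  case/setU1P=> [u'u|]; last by right; exists u'.
  by left; apply: contraNT wT => wv; rewrite in_setD wv !inE -u'u u'w orbT.
have Tu w : w \in T -> adj u w.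
  rewrite !inE negb_or => /andP[/andP[_ vw]] /orP[/eqP wu|//].
  by rewrite wu vu in vw.
have /card_gt0P[i0 _] : 0 < #|{: 'I_d.+1}| by rewrite card_ord.
pose h w := nth i0 (enum C) (index w (enum T)).
have indexT w : w \in T -> index w (enum T) < size (enum C).
  by move=> wT; rewrite -cardE cardC cardE index_mem mem_enum.
have hC w : w \in T -> h w \in C.
  by move=> wT; rewrite -mem_enum mem_nth ?indexT.
have hinj : {in T &, injective h}.
  move=> a b aT bT /eqP; rewrite nth_uniq ?enum_uniq ?indexT // => /eqP.
  by apply: (index_inj a); rewrite mem_enum.
(* Vertex [w] cannot take colour [i] because of a neighbour in a completed neighbourhood. *)
pose clash w i := [exists u' in U, exists w', [&& adj u' w', adj w w' & c w' == i]].
have [||| s sT sok] := @perm_avoiding _ T (fun a b => clash a (h b)) #|U|.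
(* For a fixed vertex, each [u'] in [U] forbids at most the colour of its one common neighbour with
   [a]. *)
- move=> a aT.
  have bound : h @: [set b in T | clash a (h b)] \subset
      \bigcup_(u' in U) c @: (nbhd u' :&: nbhd a).
    apply/subsetP => _ /imsetP[b + ->]; rewrite inE => /andP[_].
    case/existsP=> u' /andP[u'U /existsP[w' /and3P[u'w' aw' /eqP <-]]].
    by apply/bigcupP; exists u' => //; apply: imset_f; rewrite !inE u'w'.
  rewrite -(card_in_imset (f := h)); last first.
    by move=> b b' /setIdP[bT _] /setIdP[b'T _]; apply: hinj.
  apply: leq_trans (subset_leq_card bound) _; apply: card_bigcup_le1 => u' u'U.
  apply: leq_trans (leq_imset_card _ _) _; apply: card_nbhdI.
  by apply: contraTneq aT => <-; rewrite inE !in_setU (Uv _ u'U) orbT.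
(* For a fixed colour, injectivity on [cnbhd u'] leaves one possible vertex [w] of that colour. It
   is not [u], whose colour is outside [C], so [w] and [u] have at most one common neighbour, and
   only that one can be affected. *)
- move=> b bT.
  have bound : [set a in T | clash a (h b)] \subset
      \bigcup_(u' in U) [set a in T | [exists w', [&& adj u' w', adj a w' & c w' == h b]]].
    apply/subsetP => a; rewrite inE => /andP[aT /existsP[u' /andP[u'U aw']]].
    by apply/bigcupP; exists u' => //; rewrite inE aT.
  apply: leq_trans (subset_leq_card bound) _; apply: card_bigcup_le1 => u' u'U.
  apply/card_le1_eqP => a a' /setIdP[aT /existsP[w /and3P[u'w aw /eqP cw]]].
  case/setIdP=> [a'T /existsP[w' /and3P[u'w' a'w' /eqP cw']]].
  have ww' : w = w'.
    by apply: (cU u' u'U); rewrite ?inE ?u'w ?u'w' ?orbT // cw.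
  have wu : w != u.
    apply: contraTneq (hC _ bT) => wu; rewrite -cw wu inE negbK.
    by apply: imset_f; rewrite !inE eqxx vu orbT.
  apply: (common_neighbor_uniq noC4 wu); rewrite ?Tu // adjC //.
  by rewrite ww'.
(* From [#|U| < d./2], twice [#|U|] is at most [d - 2], hence at most [#|T|]. *)
- by rewrite cardT; lia.
have sTE w : (s w \in T) = (w \in T) by apply: perm_closed.
pose c' w := if w \in T then h (s w) else c w.
have c'T w : w \in T -> c' w = h (s w) by rewrite /c' => ->.
have c'N w : w \notin T -> c' w = c w by rewrite /c' => /negbTE->.
have c'inj : {in cnbhd u &, injective c'}.
  have cross a b : a \in T -> b \in cnbhd u -> b \notin T -> c' a = c' b -> a = b.
    move=> aT bu bT; rewrite c'T // c'N // => hab.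
    have : h (s a) \in C by rewrite hC ?sTE.
    rewrite hab inE => /negP[]; apply: imset_f; rewrite in_setI bu /=.
    by move: bT; rewrite in_setD bu andbT negbK.
  move=> a b au bu.
  have [aT|aT] := boolP (a \in T); have [bT|bT] := boolP (b \in T).
  - by rewrite !c'T // => /hinj; rewrite !sTE => /(_ aT bT) /perm_inj.
  - exact: cross.
  - by move=> /esym/cross->.
  - rewrite !c'N //; apply: cuv.
    + by move: aT; rewrite in_setD in_setI au andbT negbK.
    + by move: bT; rewrite in_setD in_setI bu andbT negbK.
exists c'; split=> //.
  by move=> w wb; rewrite c'N //; apply: contraTN wb => /Tball.
have cross a b : a \in T -> b \in ball v U -> adj a b -> c' a != c' b.
  move=> aT bb ab.
  have bT : b \notin T by apply: contraTN bb => /Tball.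
  have [bu|bu] := boolP (b \in cnbhd u).
    have au : a \in cnbhd u by case/setDP: aT.
    by apply/eqP => /(c'inj a b au bu) ab'; rewrite ab' adj_irrefl in ab.
  rewrite c'T // c'N // eq_sym; apply: contraNneq (sok a aT) => <-.
  case/ballP: bb => [|[u' u'U u'b]].
    rewrite !inE => /orP[/eqP bv|vb].
    - by move: bu; rewrite bv !inE adjC vu orbT.
    - have := TU a b aT; rewrite inE vb => /(_ isT); rewrite adjC ab.
      by case: eqP bu => [->|_ _ /(_ isT)//]; rewrite !inE eqxx.
  apply/existsP; exists u'; rewrite u'U; apply/existsP; exists b.
  by rewrite u'b ab eqxx.
move=> a b ab bb.
have [aT|aT] := boolP (a \in T); have [bT|bT] := boolP (b \in T) => adjab.
- apply/eqP => /c'inj; rewrite !inE !Tu // !orbT => /(_ isT isT) ab'.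
  by rewrite ab' adj_irrefl in adjab.
- by apply: cross => //; apply: ballS.
- by rewrite eq_sym; apply: cross; rewrite 1?adjC //; apply: ballS.
- by rewrite !c'N //; apply: propc => //; apply: ballS.
Qed.

Lemma dominating_neighbors v (U : {set G}) (g : G -> 'I_d.+1) :
  U \subset nbhd v -> #|U| <= d./2 -> {in cnbhd v &, injective g} ->
  exists c : G -> 'I_d.+1,
    [/\ {in cnbhd v, c =1 g}, proper_on (ball v U) c
      & {in U, forall u, {in cnbhd u &, injective c}}].
Proof.
move=> + + gv; have [n] := ubnP #|U|; elim: n U => // n IHn U.
rewrite ltnS => Un Uv Ud; have [->|[u uU]] := set_0Vmem U.
  exists g; split=> // [a b|a]; last by rewrite inE.
  rewrite /ball big_set0 setU0 => av bv ab.
  by apply/eqP => /(gv _ _ av bv) eqab; rewrite eqab adj_irrefl in ab.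
have U'U : U :\ u \subset U := subD1set U u.
have U'v := subset_trans U'U Uv.
have cardU' : #|U :\ u|.+1 = #|U| by rewrite (cardsD1 u U) uU.
have [||| c [cg propc cU']] := IHn (U :\ u); rewrite ?cardU' //.
  by apply: leq_trans Ud; rewrite -cardU'.
have sub_ball w : w \in cnbhd v -> w \in ball v (U :\ u).
  by move=> wv; apply/ballP; left.
have uv := subsetP Uv u uU.
have cv : {in cnbhd v &, injective c}.
  by move=> a b av bv; rewrite !cg //; apply: gv.
have [||c' [c'c propc' c'u]] := extend_dominating uv U'v _ _ propc cv cU'.
- by rewrite !inE eqxx.
- by rewrite cardU'.
exists c'; split.
- by move=> w wv; rewrite c'c ?cg // sub_ball.
- by rewrite setD1K in propc'.
- move=> u' u'U; have [->//|u'u] := eqVneq u' u.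
  have u'U' : u' \in U :\ u by rewrite !inE u'u.
  (* The closed neighbourhood of [u'] was coloured before [u] was treated, so the extension does not
     alter it. *)
  have c'c' : {in cnbhd u', c' =1 c}.
    move=> w wu'; apply: c'c; case/setU1P: wu' => [->|]; last first.
      by rewrite inE => u'w; apply/ballP; right; exists u'.
    by apply: sub_ball; rewrite in_setU1 (subsetP Uv) ?orbT.
  by move=> a b au' bu'; rewrite !c'c' //; apply: (cU' _ u'U').
Qed.

Lemma dominating_colors v :
  exists U : {set G}, exists c : G -> 'I_d.+1,
    [/\ U \subset nbhd v, proper_on (ball v U) c
      & forall i : 'I_d.+1, i <= d./2 ->
        exists u, [/\ cnbhd u \subset ball v U, {in cnbhd u &, injective c}
                    & c u = i]].
Proof.
pose s := v :: enum (nbhd v).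
have us : uniq s by rewrite /= mem_enum inE adj_irrefl enum_uniq.
have sizes : size s = d.+1 by rewrite /= -cardE regG.
have mems w : (w \in s) = (w \in cnbhd v) by rewrite in_cons mem_enum in_setU1.
(* This numbering gives [v] colour 0 and its neighbours colours 1 to [d]; the first [d./2]
   neighbours then carry exactly the colours 1 to [d./2]. *)
pose g w : 'I_d.+1 := inord (index w s).
have gv : {in cnbhd v &, injective g}.
  move=> a b; rewrite -!mems => asz bsz /(congr1 val) /=.
  by rewrite !inordK -?sizes ?index_mem //; apply: (index_inj v).
pose U : {set G} := [set u in take d./2 (enum (nbhd v))].
have Uv : U \subset nbhd v.
  by apply/subsetP => u; rewrite inE => /mem_take; rewrite mem_enum.
have Ud : #|U| <= d./2.
  rewrite cardsE; apply: leq_trans (card_size _) _; rewrite size_take_min.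
  exact: geq_minl.
have [c [cg propc cU]] := dominating_neighbors Uv Ud gv.
have cv : {in cnbhd v &, injective c}.
  by move=> a b av bv; rewrite !cg //; apply: gv.
exists U, c; split=> // i id; exists (nth v s i).
have iv : nth v s i \in cnbhd v by rewrite -mems mem_nth ?sizes.
have -> : c (nth v s i) = i.
  by rewrite cg // /g index_uniq ?sizes // inord_val.
case: i id iv => -[|i] /= ilt id iv.
  by split=> //; apply: subsetUl.
have uU : nth v (enum (nbhd v)) i \in U.
  have szN : size (enum (nbhd v)) = d by rewrite -cardE regG.
  rewrite inE -(nth_take v (n0 := d./2)) // mem_nth // size_take_min szN leq_min id.
  by rewrite -ltnS.
split=> //; last exact: cU.
apply/subsetP => w /setU1P[->|]; first by apply/ballP; left.
by rewrite inE => uw; apply/ballP; right; exists (nth v (enum (nbhd v)) i).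
Qed.

(** * From dominating vertices to b-colourings *)

Lemma b_coloring_leq k (c : {ffun G -> 'I_k}) : b_coloring c -> k <= d.+1.
Proof.
(* With at least one colour, a dominating vertex of colour 0 sees every colour within its closed
   neighbourhood, which has [d + 1] vertices. *)
case: k c => // k c /andP[_ /forallP/(_ ord0)/existsP[x /andP[/eqP cx domx]]].
have -> : k.+1 = #|[set: 'I_k.+1]| by rewrite cardsT card_ord.
rewrite -(card_cnbhd x); apply: leq_trans (leq_imset_card c _).
apply/subset_leq_card/subsetP => j _; have [->|j0] := eqVneq j ord0.
  by rewrite -cx imset_f // !inE eqxx.
have /existsP[y /andP[xy /eqP <-]] := implyP (forallP domx j) j0.
by rewrite imset_f // !inE xy orbT.
Qed.

Lemma dominating_b_coloring (c : G -> 'I_d.+1) :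
  proper_on setT c ->
  (forall i, exists2 u, c u = i & {in cnbhd u &, injective c}) ->
  b_coloring [ffun x => c x].
Proof.
move=> propc domc; apply/andP; split.
  by apply/forallP => x; apply/forallP => y; apply/implyP; rewrite !ffunE; apply: propc.
apply/forallP => i; have [u cu uinj] := domc i.
apply/existsP; exists u; rewrite ffunE cu eqxx.
apply/forallP => j; apply/implyP => ji.
have /eqP surj : c @: cnbhd u == setT.
  by rewrite eqEcard subsetT card_in_imset // card_cnbhd cardsT card_ord /=.
have /imsetP[z] : j \in c @: cnbhd u by rewrite surj.
case/setU1P=> [->|]; first by rewrite cu => eqji; rewrite eqji eqxx in ji.
by rewrite inE => uz jz; apply/existsP; exists z; rewrite uz ffunE jz eqxx.
Qed.

(** * Combining two distant colourings *)

Lemma far_apart_b_coloring x y :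
  (forall p : seq G, path (@adj G) x p -> last x p = y -> 5 < size p) ->
  exists c : {ffun G -> 'I_d.+1}, b_coloring c.
Proof.
move=> far.
have [U [cx [Ux propcx domx]]] := dominating_colors x.
have [V [cy [Vy propcy domy]]] := dominating_colors y.
have from_y b : b \in ball y V ->
    exists q : seq G, [/\ path (@adj G) b q, last b q = y & size q <= 2].
  case/(ball_walk Vy)=> p [yp ypb p2]; have [q [yq yqy qp]] := path_rev yp.
  by exists q; rewrite -ypb yq yqy qp.
have disj a : a \in ball x U -> a \notin ball y V.
  case/(ball_walk Ux)=> p [xp xpa p2]; apply/negP => /from_y[q [aq aqy q2]].
  have := far (p ++ q); rewrite cat_path xp last_cat xpa aq aqy size_cat.
  by move=> /(_ isT erefl); lia.
(* Such an edge would give a walk from [x] to [y] of length at most 2 + 1 + 2 = 5. *)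
have nadj a b : a \in ball x U -> b \in ball y V -> ~~ adj a b.
  case/(ball_walk Ux)=> p [xp xpa p2] /from_y[q [bq bqy q2]]; apply/negP => ab.
  have := far (p ++ b :: q); rewrite cat_path last_cat /= xp xpa ab bq bqy size_cat.
  by move=> /(_ isT erefl) /=; lia.
(* Reversal sends colour [i] to [d - i], so the colours dominated near [y] become those from
   [d - d./2] up to [d]; with 0 to [d./2] near [x], every colour is covered. *)
pose c w := if w \in ball x U then cx w else rev_ord (cy w).
have cBx : {in ball x U, c =1 cx} by move=> w; rewrite /c => ->.
have cBy : {in ball y V, c =1 (fun w => rev_ord (cy w))}.
  by move=> w wy; rewrite /c ifN //; apply: contraTN wy => /disj.
have propc : proper_on (ball x U :|: ball y V) c.
  move=> a b /setUP[aB|aB] /setUP[bB|bB] ab.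
  - by rewrite !cBx //; apply: propcx.
  - by rewrite (negbTE (nadj a b aB bB)) in ab.
  - by rewrite adjC (negbTE (nadj b a bB aB)) in ab.
  - by rewrite !cBy // (inj_eq rev_ord_inj); apply: propcy.
have degd w : #|nbhd w| < d.+1 by rewrite regG.
have [c' c'c propc'] := greedy_extension degd propc.
have c'x u : cnbhd u \subset ball x U -> {in cnbhd u, c' =1 cx}.
  by move=> /subsetP uB w /uB wB; rewrite c'c ?cBx //; apply/setUP; left.
have c'y u : cnbhd u \subset ball y V -> {in cnbhd u, c' =1 (fun w => rev_ord (cy w))}.
  by move=> /subsetP uB w /uB wB; rewrite c'c ?cBy //; apply/setUP; right.
have uu u : u \in cnbhd u by apply: setU11.
exists [ffun w => c' w]; apply: dominating_b_coloring => // i.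
have [id|id] := leqP i d./2.
  have [u [uB uinj cu]] := domx i id; exists u; first by rewrite (c'x u).
  by move=> a b au bu; rewrite !(c'x u) //; apply: uinj.
have [|u [uB uinj cu]] := domy (rev_ord i).
  by have := ltn_ord i; rewrite /=; lia.
exists u; first by rewrite (c'y u) // cu rev_ordK.
by move=> a b au bu; rewrite !(c'y u) // => /rev_ord_inj; apply: uinj.
Qed.

End RegularC4Free.
End Colorings.

Theorem theorem4 (d : nat) (G : sgraph) :
  regular d G ->
  ~ contains_cycle 4 G ->
  (6%:E <= diam G)%E ->
  b_chromatic G = d.+1.
Proof.
move=> regG noC4 /diam_far_apart[x [y far]].
have [c bc] := far_apart_b_coloring regG noC4 far.
apply/eqP; rewrite eqn_leq; apply/andP; split.
  by apply/bigmax_leqP => k /existsP[c' /(b_coloring_leq regG)].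
(* The maximum in [b_chromatic] is over [k] at most [#|G|]; a closed neighbourhood shows that
   [d + 1] is in range. *)
have dG : d.+1 < #|{: G}|.+1 by rewrite ltnS -(card_cnbhd regG x) max_card.
apply: (@leq_bigmax_cond _ _ _ (Ordinal dG)).
by apply/existsP; exists c.
Qed.
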